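(* Let $X$ be a continuum, $n\in\mathbb N$ and $A\in 2^X$. Then $A\in CC_n(X)$ if and only if $X$ is aposyndetic with respect to $A$ and $A\in NC_n(X)$.
   Context: All spaces are metric; a continuum is a compact connected space with more than one point; $\mathbb N=\{1,2,\dots\}$. For a non-empty space $Y$ and $n\in\mathbb N$: $2^Y$ is the set of non-empty compact subsets of $Y$; $F_n(Y)$ is the set of elements of $2^Y$ with at most $n$ points. A non-empty space $Y$ is $n$-$Q1$ if there exists $B\in F_n(Y)$ such that for each $x\in Y$ there exists a continuum $D\subset Y$ with $x\in \mathrm{int}_Y(D)$ and $B\cap D\neq\emptyset$. For a continuum $X$: $CC_n(X)=\{A\in 2^X: A=X$ or $X-A$ is $n$-$Q1\}$; $NC_n(X)=\{A\in 2^X: X-A$ has at most $n$ components$\}$. A continuum $X$ is aposyndetic with respect to $A\subset X$ if for every $p\in X-A$ there is a continuum $B\subset X-A$ such that $p\in\mathrm{int}_X(B)$. *)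

(* Defs.v *)
From HB Require Import structures.
From mathcomp Require Import all_boot all_order all_algebra.
From mathcomp Require Import all_classical all_reals all_analysis.

Set Implicit Arguments.
Unset Strict Implicit.
Unset Printing Implicit Defensive.

Local Open Scope classical_set_scope.
Local Open Scope card_scope.

(* A space is given as a subset Y of an ambient topological space T, with the
   induced topology; the whole space is the case Y = [set: T].  For C `<=` Y,
   being compact or connected does not depend on whether C is seen in Y or in
   T.  The interior does, whence the use of [subspace Y] in [nQ1]. *)

Definition continuum (T : topologicalType) (C : set T) : Prop :=
  [/\ compact C, connected C & exists x y, [/\ C x, C y & x <> y]].

Definition hyperspace (T : topologicalType) (Y : set T) : set (set T) :=
  [set A | [/\ A `<=` Y, A !=set0 & compact A]].

Definition hyperspaceF (T : topologicalType) (n : nat) (Y : set T) :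
    set (set T) :=
  [set B | hyperspace Y B /\ B #<= `I_n].

Definition nQ1 (T : topologicalType) (n : nat) (Y : set T) : Prop :=
  Y !=set0 /\
  exists2 B : set T, hyperspaceF n Y B &
    forall x : T, Y x -> exists D : set T,
      [/\ D `<=` Y, continuum D,
          @interior (subspace Y) D x & B `&` D !=set0].

Definition components (T : topologicalType) (Y : set T) : set (set T) :=
  connected_component Y @` Y.

Definition CC (X : topologicalType) (n : nat) : set (set X) :=
  [set A | hyperspace [set: X] A /\ (A = [set: X] \/ nQ1 n (~` A))].

Definition NC (X : topologicalType) (n : nat) : set (set X) :=
  [set A | hyperspace [set: X] A /\ components (~` A) #<= `I_n].

Definition aposyndetic_wrt (X : topologicalType) (A : set X) : Prop :=
  forall p : X, (~` A) p -> exists B : set X,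
    [/\ B `<=` ~` A, continuum B & interior B p].

(* Main.v *)
Require Import Defs.
From mathcomp Require Import all_boot all_order all_algebra.
From mathcomp Require Import all_classical all_reals all_analysis.

Local Open Scope classical_set_scope.

(** Write [Y] for the complement of [A]; it is open, because a compact subset
    of a metric space is closed.  Interiors in [Y] and in [X] therefore agree,
    and both sides of the equivalence say that every point of [Y] has a
    neighbourhood that is a continuum inside [Y]; they differ only in how the
    number [n] is used.

    If [B] witnesses that [Y] is [n]-[Q1], the continuum through a point [x]
    that meets [B] lies in the component of [x], so every component of [Y]
    contains a point of [B], and there are at most [n] of them
    ([card_components_le]).

    Conversely, pick one point in each component to form [B].  The neighbourhood
    of [x] given by aposyndesis need not contain the point of [B] in the
    component of [x], and has to be enlarged.  This is possible because the
    set of points that can be reached from [x] by enlarging is open, and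
    relatively closed in [Y], so it contains the whole component of [x]
    ([continuum_nbhs_component]). *)

Section ContinuumNeighbourhoods.
Context {T : topologicalType}.
Implicit Types (A B C D Y : set T) (x y : T).

Lemma continuumU C D :
  C `&` D !=set0 -> continuum C -> continuum D -> continuum (C `|` D).
Proof.
move=> CD [cC kC [x [y [Cx Cy xy]]]] [cD kD _]; split.
- exact: compactU.
- exact: connectedU.
- by exists x, y; split=> //; left.
Qed.

(** A chain of overlapping continuum neighbourhoods inside [Y] joins any two
    points of one component of [Y]; the union of such a chain is [D].  The
    chain is hidden in a connectedness argument: adding the continuum
    neighbourhood of a point [z] to one that already meets it shows that the
    set of admissible [y] is both open and relatively closed. *)
Lemma continuum_nbhs_component Y :
  (forall p, Y p -> exists D, [/\ D `<=` Y, continuum D & interior D p]) ->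
  forall x y, connected_component Y x y ->
  exists D, [/\ D `<=` Y, continuum D, interior D x & D y].
Proof.
move=> nbY x y xy.
pose S := [set z | exists D, [/\ D `<=` Y, continuum D, interior D x & D z]].
have Yx : Y x by apply: connected_component_sub (connected_component_sym xy).
have extend z K w : S z -> K `<=` Y -> continuum K -> K z -> K w -> S w.
  move=> [D [DY cD Dx Dz]] KY cK Kz Kw; exists (D `|` K); split.
  - by rewrite subUset.
  - by apply: continuumU => //; exists z.
  - by apply: interiorU; left.
  - by right.
have oS : open S.
  rewrite openE => z Sz; have Yz : Y z by case: Sz => D [DY _ _ /DY].
  have [K [KY cK Kz]] := nbY z Yz.
  have := Kz; apply: filterS => w.
  exact: extend Sz KY cK (nbhs_singleton Kz).
have clS : Y `&` closure S `<=` S.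
  move=> z [Yz clz]; have [K [KY cK Kz]] := nbY z Yz.
  have [w [Sw Kw]] := clz K Kz.
  exact: extend Sw KY cK Kw (nbhs_singleton Kz).
have Sx : S x.
  have [D [DY cD Dx]] := nbY x Yx.
  by exists D; split=> //; exact: nbhs_singleton.
suff CS : connected_component Y x `&` S = connected_component Y x.
  by move: xy; rewrite -CS => -[].
apply: (component_connected (A := Y) (x := x)).
- by exists x; split=> //; exact: connected_component_refl.
- by exists S.
- exists (closure S); first exact: closed_closure.
  apply/seteqP; split=> z [Cz Sz]; split=> //; first exact: subset_closure.
  by apply: clS; split=> //; exact: connected_component_sub Cz.
Qed.

Lemma card_components_le Y B :
  (forall x, Y x -> exists2 b, B b & connected_component Y x b) ->
  (components Y #<= B)%card.
Proof.
move=> meetB.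
have sub : components Y `<=` connected_component Y @` B.
  move=> _ [x Yx <-]; have [b Bb xb] := meetB x Yx.
  by exists b => //; rewrite (same_connected_component xb).
exact: card_le_trans (subset_card_le sub) (card_image_le _ _).
Qed.

Lemma components_transversal Y : Y !=set0 ->
  exists B, [/\ B `<=` Y, (B #<= components Y)%card &
    forall x, Y x -> exists2 b, B b & connected_component Y x b].
Proof.
move=> [x0 Yx0]; pose g (C : set T) := xget x0 C.
have gP x : Y x -> connected_component Y x (g (connected_component Y x)).
  by move=> Yx; apply: (xgetPex x0); exists x; exact: connected_component_refl.
exists (g @` components Y); split.
- by move=> _ [_ [x Yx <-] <-]; exact: connected_component_sub (gP x Yx).
- exact: card_image_le.
- move=> x Yx; exists (g (connected_component Y x)); last exact: gP.
  by exists (connected_component Y x) => //; exists x.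
Qed.

Lemma interior_subspace_open Y D x : open Y -> Y x ->
  @interior (subspace Y) D x <-> interior D x.
Proof.
move=> oY Yx; rewrite /interior /= -(@nbhs_subspace_interior _ Y x) //.
by move/interior_id: oY => ->.
Qed.

End ContinuumNeighbourhoods.

Theorem corollary5p13 (R : realType) (X : metricType R) (n : nat) (A : set X)
  (hX : continuum [set: X]) (hn : (0 < n)%N) (hA : hyperspace [set: X] A) :
  CC n A <-> aposyndetic_wrt A /\ NC n A.
Proof.
have [_ _ cptA] := hA.
have oY : open (~` A).
  by apply: closed_openC; apply: compact_closed cptA; exact: metric_hausdorff.
split=> [[_ [AT | [_ [B [[BY B0 cB] Bn] nbY]]]] | [apo [_ compn]]].
- split; first by move=> p; rewrite AT setCT.
  by split=> //; rewrite /components AT setCT image_set0; exact: card_ge0.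
- split.
    move=> p Yp; have [D [DY cD Dp _]] := nbY p Yp.
    by exists D; split=> //; apply/(interior_subspace_open _ _ _ oY Yp).
  split=> //; apply: card_le_trans Bn; apply: card_components_le => x Yx.
  have [D [DY [_ kD _] /(interior_subspace_open _ _ _ oY Yx) Dx [b [Bb Db]]]] :=
    nbY x Yx.
  by exists b => //; exact: connected_component_max (nbhs_singleton Dx) DY kD _ Db.
- split=> //; have [YE | /set0P Y0] := eqVneq (~` A) set0.
    by left; rewrite -(setCK A) YE setC0.
  right; split=> //.
  have [B [BY Bcomp meetB]] := components_transversal _ Y0.
  have Bn : (B #<= `I_n)%card := card_le_trans Bcomp compn.
  exists B.
    split=> //; split=> //.
      by have [x Yx] := Y0; have [b Bb _] := meetB x Yx; exists b.
    by apply: finite_compact; apply/finite_set_leP; exists n.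
  move=> x Yx; have [b Bb xb] := meetB x Yx.
  have [D [DY cD Dx Db]] := continuum_nbhs_component _ apo _ _ xb.
  exists D; split=> //; last by exists b.
  exact/(interior_subspace_open _ _ _ oY Yx).
Qed.
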